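(* Let $p\ge 3$ be a prime number, let $a\ge 1$ be an integer and let $n=p^a$. Then every subset $E$ of $\mathbb{Z}/n\mathbb{Z}$ is uniquely determined up to translations by its $3$-deck: if $F\subset\mathbb{Z}/n\mathbb{Z}$ satisfies $N_F=N_E$, then $F=E-t$ for some $t\in\mathbb{Z}/n\mathbb{Z}$.
   Context: For a subset $E$ of $\mathbb{Z}/n\mathbb{Z}$, the $3$-deck of $E$ is the function on $(\mathbb{Z}/n\mathbb{Z})^2$ given by $N_E(x_1,x_2)=|E\cap(E-x_1)\cap(E-x_2)|$, where $|\cdot|$ denotes cardinality. *)

(* Defs.v *)
From mathcomp Require Import all_boot all_order all_algebra.

Set Implicit Arguments.
Unset Strict Implicit.
Unset Printing Implicit Defensive.

Import GRing.Theory.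
Local Open Scope ring_scope.

(* 'Z_n is Z/nZ only for n > 1. *)

(* E - t *)
Definition translate (n : nat) (E : {set 'Z_n}) (t : 'Z_n) : {set 'Z_n} :=
  [set x - t | x in E].

(* N_E, for E a subset of Z/nZ *)
Definition deck3 (n : nat) (E : {set 'Z_n}) (x1 x2 : 'Z_n) : nat :=
  #|E :&: translate E x1 :&: translate E x2|.

(* Main.v *)
(* Let A and B be the discrete Fourier transforms of E and F. Equality of the
   3-decks means B(k) B(l) B(m) = A(k) A(l) A(m) whenever k + l + m = 0 mod n, so
   A and B vanish together and h = B / A satisfies h(k + l) = h(k) h(l) when k, l
   and k + l are in the support S of A. By Galois conjugation, membership of k in S
   only depends on the p-adic valuation of k. If q = p^j is the least power of p
   in S, then S lies in qZ and contains q m for all m prime to p; since p is odd,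
   every q m in S is reached from q by adding q or 2 q within S, so
   h(q m) = h(q)^m. As h(q) is an (n / q)-th root of unity, h is the restriction
   of a character and F is a translate of E. *)
Require Import Defs.
From mathcomp Require Import all_boot all_order all_algebra all_field.

Set Implicit Arguments.
Unset Strict Implicit.
Unset Printing Implicit Defensive.

Import GRing.Theory Num.Theory.
Section Deck.

Local Open Scope ring_scope.

(** Frequencies are natural numbers, so that induction on them is possible; they matter only modulo
    [n]. *)
Definition dft (n : nat) (z : algC) (E : {set 'Z_n}) (k : nat) : algC :=
  \sum_(x in E) (z ^+ x) ^+ k.

Section Fourier.

Variables (n : nat) (z : algC).
Hypotheses (n_gt1 : (1 < n)%N) (z_prim : n.-primitive_root z).

Implicit Types (E F : {set 'Z_n}) (x y t : 'Z_n).

Lemma exp_ZpD x y : z ^+ (x + y)%R = z ^+ x * z ^+ y.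
Proof.
rewrite -exprD -[RHS](prim_expr_mod z_prim).
(* Addition in ['Z_n] reduces modulo [(Zp_trunc n).+2], which is [n] because [1 < n]. *)
by congr (z ^+ (_ %% _)); exact: Zp_cast.
Qed.

Lemma exp_Zp_neq0 x : z ^+ x != 0.
Proof. by rewrite expf_neq0 // (prim_root_eq0 z_prim) -lt0n ltnW. Qed.

Lemma exp_ZpN x : z ^+ (- x)%R = (z ^+ x)^-1.
Proof.
by apply: (mulfI (exp_Zp_neq0 x)); rewrite -exp_ZpD addrN expr0 divff // exp_Zp_neq0.
Qed.

Lemma exp_Zp_expn x : (z ^+ x) ^+ n = 1.
Proof. by rewrite exprAC (prim_expr_order z_prim) expr1n. Qed.

Lemma exp_Zp_dvdn x k : (n %| k)%N -> (z ^+ x) ^+ k = 1.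
Proof. by case/dvdnP=> q ->; rewrite mulnC exprM exp_Zp_expn expr1n. Qed.

Lemma dft_periodic E k l : (n %| l)%N -> dft z E (k + l) = dft z E k.
Proof. by move=> nl; apply: eq_bigr => x _; rewrite exprD (exp_Zp_dvdn _ nl) mulr1. Qed.

Lemma dft0 E : dft z E 0 = #|E|%:R.
Proof. by rewrite /dft -sumr_const; apply: eq_bigr => x _; rewrite expr0. Qed.

Lemma mem_translate E t x : (x \in translate E t) = (x + t \in E).
Proof.
apply/imsetP/idP => [[y Ey ->]|Ext]; first by rewrite subrK.
by exists (x + t); rewrite ?addrK.
Qed.

Lemma dft_translate E t k : dft z (translate E t) k = dft z E k * ((z ^+ t) ^+ k)^-1.
Proof.
rewrite /dft (reindex_inj (addIr (- t))) mulr_suml.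
apply: eq_big => x; first by rewrite mem_translate subrK.
by move=> _; rewrite exp_ZpD exp_ZpN exprMn exprVn.
Qed.

Lemma dft_inversion E y :
  \sum_(k < n) dft z E k * (z ^+ (- y)%R) ^+ k = n%:R * (y \in E)%:R.
Proof.
under eq_bigr do rewrite mulr_suml; rewrite exchange_big.
under eq_bigr => x _.
  under eq_bigr do rewrite -exprMn -exp_ZpD.
  over.
have geo x : \sum_(k < n) (z ^+ (x - y)%R) ^+ k = n%:R * (x == y)%:R.
  have [->|ne_xy] := eqVneq x y.
    by rewrite subrr mulr1; under eq_bigr do rewrite expr1n; rewrite sumr_const card_ord.
  have ne1 : z ^+ (x - y)%R - 1 != 0.
    rewrite subr_eq0 -(prim_order_dvd z_prim); apply: contra ne_xy => dv.
    rewrite -subr_eq0 -val_eqE -leqn0 leqNgt; apply/negP => gt0.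
    have := leq_trans (ltn_ord (x - y)) (eq_leq (Zp_cast n_gt1)).
    by rewrite ltnNge dvdn_leq.
  by apply: (mulfI ne1); rewrite -subrX1 exp_Zp_expn subrr !mulr0.
under eq_bigr do rewrite geo.
rewrite -mulr_sumr; congr (_ * _).
have [Ey|nEy] := boolP (y \in E).
  by rewrite (bigD1 y) //= eqxx big1 ?addr0 // => x /andP[_ /negPf->].
by rewrite big1 // => x Ex; case: eqP Ex nEy => // -> ->.
Qed.

Lemma dft_inj E F : dft z E =1 dft z F -> E = F.
Proof.
move=> eqEF; apply/setP=> y.
have n_neq0 : n%:R != 0 :> algC by rewrite pnatr_eq0 -lt0n ltnW.
have : n%:R * (y \in E)%:R = n%:R * (y \in F)%:R :> algC.
  by rewrite -!dft_inversion; apply: eq_bigr => k _; rewrite eqEF.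
by move/(mulfI n_neq0)/eqP; rewrite eqr_nat; do 2!case: (_ \in _).
Qed.

(** Expand the factor at [m] over [e] in [E]. As [m] is [- (k + l)] modulo [n], its phase splits
    between the other two factors and turns them into transforms of [E - e]; summing over [e] first
    yields the deck. *)
Lemma dft_deck3 E k l m : (n %| k + l + m)%N ->
  dft z E k * dft z E l * dft z E m =
  \sum_x1 \sum_x2 (deck3 E x1 x2)%:R * ((z ^+ x1) ^+ k * (z ^+ x2) ^+ l).
Proof.
move=> dvd_klm.
have shift i (e : 'Z_n) : dft z E i * ((z ^+ e) ^+ i)^-1 = \sum_x (e + x \in E)%:R * (z ^+ x) ^+ i.
  rewrite -dft_translate /dft big_mkcond; apply: eq_bigr => x _.
  by rewrite mem_translate addrC; case: ifP; rewrite ?mul1r ?mul0r.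
transitivity (\sum_(e in E) (dft z E k * ((z ^+ e) ^+ k)^-1) * (dft z E l * ((z ^+ e) ^+ l)^-1)).
  rewrite [dft z E m]/dft mulr_sumr; apply: eq_bigr => e _.
  rewrite mulrACA -invfM -exprD; congr (_ * _).
  apply: (mulfI (expf_neq0 (k + l) (exp_Zp_neq0 e))).
  by rewrite -exprD exp_Zp_dvdn // divff // expf_neq0 // exp_Zp_neq0.
under eq_bigr => e _ do rewrite !shift mulr_suml.
rewrite exchange_big; apply: eq_bigr => x1 _.
under eq_bigr => e _ do rewrite mulr_sumr.
rewrite exchange_big; apply: eq_bigr => x2 _.
rewrite /deck3 -sum1_card natr_sum mulr_suml big_mkcond [RHS]big_mkcond /=.
apply: eq_bigr => e _; rewrite !inE !mem_translate mulrACA -natrM mulnb.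
by case: (e \in E) => //=; case: (_ && _); rewrite ?mul1r ?mul0r.
Qed.

(* Multiplying a frequency by a unit modulo n is a Galois conjugation. *)
Lemma dft_coprime_eq0 E u k : coprime u n -> (dft z E (k * u) == 0) = (dft z E k == 0).
Proof.
move=> co_un; have [nu nuE] := Qn_aut_exists co_un.
rewrite -[RHS](fmorph_eq0 nu) [in RHS]rmorph_sum; congr (_ == 0); apply: eq_bigr => x _.
by rewrite exprM nuE // [LHS]exprAC exp_Zp_expn expr1n.
Qed.

End Fourier.

Section SameDeck.

Variables (n : nat) (z : algC).
Hypotheses (n_gt1 : (1 < n)%N) (z_prim : n.-primitive_root z).
Variables (E F : {set 'Z_n}).
Hypothesis eq_deck : forall x1 x2, deck3 F x1 x2 = deck3 E x1 x2.

Lemma deck3_00 (A : {set 'Z_n}) : deck3 A 0 0 = #|A|.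
Proof. by apply: eq_card => x; rewrite !inE !mem_translate !addr0 !andbb. Qed.

Lemma eq_deck_card : #|F| = #|E|.
Proof. by rewrite -!deck3_00 eq_deck. Qed.

Lemma eq_deck_dft k l m : (n %| k + l + m)%N ->
  dft z F k * dft z F l * dft z F m = dft z E k * dft z E l * dft z E m.
Proof.
move=> dv; rewrite !dft_deck3 //.
by apply: eq_bigr => x1 _; apply: eq_bigr => x2 _; rewrite eq_deck.
Qed.

Hypothesis E_neq0 : E != set0.

(** This is [h = B / A]; off the support of [A] it takes the default value 0. *)
Let ratio k := dft z F k / dft z E k.

Lemma dft0_neq0 : dft z E 0 != 0.
Proof. by rewrite dft0 pnatr_eq0 cards_eq0. Qed.

(** The frequency [k * n.-1] stands for [- k], and [n.-1] is a unit modulo [n]. *)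
Lemma dft_opp_eq0 (A : {set 'Z_n}) k : (dft z A (k * n.-1) == 0) = (dft z A k == 0).
Proof. by rewrite (dft_coprime_eq0 z_prim) // coprimePn // ltnW. Qed.

Lemma dvdn_add_opp k : (n %| k + k * n.-1)%N.
Proof. by rewrite -mulnS prednK ?dvdn_mull // ltnW. Qed.

(** Apply the triple identity to [k], [- k], 0 and cancel the common nonzero value at 0, the
    cardinality. *)
Lemma eq_deck_dft_eq0 k : (dft z F k == 0) = (dft z E k == 0).
Proof.
have /eq_deck_dft : (n %| k + k * n.-1 + 0)%N by rewrite addn0 dvdn_add_opp.
rewrite !(dft0 z) eq_deck_card -(dft0 z) => /(mulIf dft0_neq0) /(congr1 (eq_op^~ 0)).
by rewrite !mulf_eq0 !dft_opp_eq0 !orbb.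
Qed.

Lemma ratio0 : ratio 0 = 1.
Proof. by rewrite /ratio !dft0 eq_deck_card -(dft0 z) divff ?dft0_neq0. Qed.

Lemma ratio_triple k l m : dft z E k != 0 -> dft z E l != 0 -> dft z E m != 0 ->
  (n %| k + l + m)%N -> ratio k * ratio l * ratio m = 1.
Proof.
move=> k0 l0 m0 dv; rewrite /ratio !mulf_div eq_deck_dft //.
by rewrite divff // !mulf_neq0.
Qed.

(** With [m = - (k + l)], the triples [(k + l, 0, m)] and [(k, l, m)] both give product 1; cancel
    [ratio m]. *)
Lemma ratioD k l : dft z E k != 0 -> dft z E l != 0 -> dft z E (k + l) != 0 ->
  ratio (k + l) = ratio k * ratio l.
Proof.
move=> k0 l0 kl0; pose m := ((k + l) * n.-1)%N.
have m0 : dft z E m != 0 by rewrite dft_opp_eq0.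
have r1 : ratio (k + l) * ratio 0 * ratio m = 1.
  by rewrite ratio_triple ?dft0_neq0 // addn0 dvdn_add_opp.
have r2 : ratio k * ratio l * ratio m = 1 by rewrite ratio_triple // dvdn_add_opp.
have rm0 : ratio m != 0 by rewrite mulf_neq0 ?invr_eq0 // eq_deck_dft_eq0.
by apply: (mulIf rm0); rewrite r2 -r1 ratio0 mulr1.
Qed.

(* If p divides m.+1 we pass from m to m.+2 in one step, which needs p <> 2. *)
Lemma ratio_expn p q m : prime p -> (2 < p)%N ->
    (forall i, ~~ (p %| i)%N -> dft z E (q * i) != 0) ->
  dft z E (q * m) != 0 -> ratio (q * m) = ratio q ^+ m.
Proof.
move=> p_prime p_gt2 supp.
have p_ndvd1 : ~~ (p %| 1)%N by rewrite dvdn1 neq_ltn (ltn_trans _ p_gt2) ?orbT.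
have q0 : dft z E q != 0 by rewrite -[q]muln1 supp.
have q2 : dft z E (q * 2) != 0 by rewrite supp // gtnNdvd.
have step k l : dft z E (q * k) != 0 -> dft z E (q * l) != 0 ->
    ratio (q * k) = ratio q ^+ k -> ratio (q * l) = ratio q ^+ l ->
    dft z E (q * (k + l)) != 0 -> ratio (q * (k + l)) = ratio q ^+ (k + l).
  by move=> k0 l0 rk rl kl0; rewrite mulnDr ratioD -?mulnDr // rk rl exprD.
have r1 : ratio (q * 1) = ratio q ^+ 1 by rewrite muln1 expr1.
have r2 : ratio (q * 2) = ratio q ^+ 2 by rewrite (step 1 1)%N // muln1.
elim/ltn_ind: m => -[|[|m]] IH m0; rewrite ?muln0 ?ratio0 //.
(* If [q * m.+1] is in the support, add [q] to it; otherwise [p] divides [m.+1], hence not [m], and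
   [2 q] is added to [q * m]. *)
have [m1|m1] := eqVneq (dft z E (q * m.+1)) 0; last first.
  by rewrite -addn1 step ?muln1 // ?IH // addn1.
have dv : (p %| m.+1)%N by apply: contraTT isT => /supp; rewrite m1 eqxx.
have m0' : dft z E (q * m) != 0.
  by rewrite supp //; apply: contra p_ndvd1 => dvm; rewrite -(dvdn_addr 1 dvm) addn1.
by rewrite -addn2 step ?r2 ?addn2 // IH.
Qed.

Lemma eq_deck_dft_shift p a : prime p -> (2 < p)%N -> n = (p ^ a)%N ->
  exists i, forall k, dft z F k = dft z E k * (z ^+ i) ^+ k.
Proof.
move=> p_prime p_gt2 nE; have p_gt1 := prime_gt1 p_prime.
have level i u : ~~ (p %| u)%N -> (dft z E (p ^ i * u) == 0) = (dft z E (p ^ i) == 0).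
  by move=> ndv; rewrite (dft_coprime_eq0 z_prim) // nE coprime_sym coprimeXl // prime_coprime.
(* The frequency [p ^ a] is 0 modulo [n], so a least power of [p] in the support exists. *)
have supp_a : dft z E (p ^ a) != 0.
  by rewrite -nE -[X in dft z E X]add0n (dft_periodic z_prim) // dft0_neq0.
have ex_level : exists j, dft z E (p ^ j) != 0 by exists a.
have [j j_supp j_min] := ex_minnP ex_level.
have le_ja : (j <= a)%N by exact: j_min.
have dvd_supp k : dft z E k != 0 -> (p ^ j %| k)%N.
  have [->|k_gt0] := posnP k; first by rewrite dvdn0.
  have [i ndv kE] := pfactor_coprime p_prime k_gt0.
  rewrite kE mulnC level -?prime_coprime // => /j_min le_ji.
  by rewrite dvdn_mulr // dvdn_exp2l.
have supp u : ~~ (p %| u)%N -> dft z E (p ^ j * u) != 0 by move=> ndv; rewrite level.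
set q := (p ^ j)%N in j_supp dvd_supp supp.
have nqE : n = (q * p ^ (a - j))%N by rewrite -expnD subnKC.
have ratioE := ratio_expn p_prime p_gt2 supp.
(* Since [q * (n / q + 1) = q + n], periodicity gives [h(q)^(n / q + 1) = h(q)]. *)
have rq1 : ratio q ^+ (p ^ (a - j)) = 1.
  have rq0 : ratio q != 0 by rewrite mulf_neq0 ?invr_eq0 // eq_deck_dft_eq0.
  apply: (mulfI rq0); rewrite mulr1 -exprS -ratioE mulnS -nqE ?(dft_periodic z_prim) //.
  by rewrite /ratio !(dft_periodic z_prim).
have zq_prim : (p ^ (a - j)).-primitive_root (z ^+ q).
  have := dvdn_prim_root z_prim (_ : p ^ (a - j) %| n)%N.
  by rewrite nqE mulnK ?expn_gt0 ?(ltnW p_gt1) //; apply; rewrite dvdn_mull.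
(* As [z ^+ q] is a primitive [n / q]-th root of unity, [h(q)] is a power of it; the exponent is the
   shift. *)
have [i rqE] := prim_rootP zq_prim rq1.
exists (i : nat) => k; have [k0|k0] := eqVneq (dft z E k) 0.
  by rewrite k0 mul0r; apply/eqP; rewrite eq_deck_dft_eq0 k0.
have /dvdnP[m kE] := dvd_supp k k0; rewrite mulnC in kE.
rewrite -[LHS](divfK k0) mulrC; congr (_ * _).
by rewrite -/(ratio k) [in LHS]kE ratioE -?kE // rqE [in RHS]kE -!exprM [in RHS]mulnCA mulnA.
Qed.

End SameDeck.

End Deck.

Theorem theorem3p1 (p a : nat) (p_prime : prime p) (p_ge3 : 3 <= p)
    (a_ge1 : 1 <= a) (E F : {set 'Z_(p ^ a)}) :
  (forall x1 x2 : 'Z_(p ^ a), deck3 F x1 x2 = deck3 E x1 x2) ->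
  exists t : 'Z_(p ^ a), F = translate E t.
Proof.
(* The empty set is treated apart because the argument divides by the transform at 0, which is the
   cardinality of [E]. *)
move=> eq_deck; have [E0|E_neq0] := eqVneq E set0.
  exists 0%R; have /eqP := eq_deck_card eq_deck.
  rewrite E0 cards0 cards_eq0 => /eqP->.
  by apply/setP => x; rewrite mem_translate !inE.
have p_gt1 := prime_gt1 p_prime.
have n_gt1 : 1 < p ^ a by rewrite -[1](exp1n a) ltn_exp2r.
have [z z_prim] := C_prim_root_exists (ltnW n_gt1).
have [i shiftE] := eq_deck_dft_shift n_gt1 z_prim eq_deck E_neq0 p_prime p_ge3 erefl.
(* Passing to [E - t] multiplies the transform at [k] by [z^(- t k)], whence the sign. *)
exists (- i%:R)%R; apply: (dft_inj n_gt1 z_prim) => k.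
rewrite (dft_translate n_gt1 z_prim) shiftE (exp_ZpN n_gt1 z_prim).
by rewrite val_Zp_nat // (prim_expr_mod z_prim) exprVn invrK.
Qed.
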